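(* Let $c$ be the greatest letter of $A$ and let $Z\subset\mathcal{A}$ be the linear span of all words in $W_A$ (including the empty word $e$) that do not begin with the letter $c$. Then $\mathcal{A}$ has the direct sum decomposition $$\mathcal{A}=Z\oplus(Z ⧢ c)\oplus(Z ⧢ c^{⧢ 2})\oplus\cdots=\bigoplus_{k\ge0}\left(Z ⧢ c^{⧢ k}\right).$$
   Context: Let $A$ be a finite non-empty totally ordered alphabet, $W_A$ the set of all words over $A$ including the empty word $e$, and $\mathcal{A}$ the real vector space with basis $W_A$. $⧢$ denotes the usual shuffle product on $\mathcal{A}$ (commutative, associative, unit $e$). $c^{⧢ k}$ is the $k$-th shuffle power of the letter $c$ (with $c^{⧢ 0}=e$), and $Z ⧢ c^{⧢ k}=\{z ⧢ c^{⧢ k}: z\in Z\}$. *)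

(* Defs.v *)
From mathcomp Require Import all_boot all_order all_algebra.
From mathcomp Require Import finmap.
From mathcomp Require Import boolp classical_sets reals.
From mathcomp.multinomials Require Import monalg.

Set Implicit Arguments.
Unset Strict Implicit.
Unset Printing Implicit Defensive.

Import Order.TTheory GRing.Theory Num.Theory.

Local Open Scope classical_set_scope.
Local Open Scope ring_scope.

Section LinearAlgebra.
Context {R : nzRingType} {V : lmodType R}.

Definition linear_span (S : set V) : set V :=
  [set v | exists2 s : seq (R * V),
     (forall p, p \in s -> S p.2) & v = \sum_(p <- s) p.1 *: p.2].

Definition is_linear_subspace (U : set V) : Prop :=
  U 0 /\ forall (a : R) (u v : V), U u -> U v -> U (a *: u + v).

(* A family indexed by an infinite set decomposes a vector into finitely many
   nonzero components, whence the finitely supported choice of components. *)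
Definition is_direct_sum (U : nat -> set V) : Prop :=
  (forall k, is_linear_subspace (U k)) /\
  (forall v : V, exists! f : {fsfun nat -> V with 0},
     (forall k, U k (f k)) /\ v = \sum_(k <- finsupp f) f k).

End LinearAlgebra.

(* All the interleavings of two words, listed with multiplicity:
   au ⧢ bv = a(u ⧢ bv) + b(au ⧢ v). *)
Fixpoint word_shuffle (A : Type) (u : seq A) : seq A -> seq (seq A) :=
  if u is a :: u' then
    fix shuffle_u (v : seq A) : seq (seq A) :=
      if v is b :: v' then
        map (cons a) (word_shuffle u' v) ++ map (cons b) (shuffle_u v')
      else [:: u]
  else fun v => [:: v].

Section Shuffle.
Context {R : nzRingType} {A : choiceType}.

(* {malg R[seq A]} is only used as the free R-module on words, with << w >>
   the basis vector of w. *)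
Definition shuffle (p q : {malg R[seq A]}) : {malg R[seq A]} :=
  \sum_(u <- msupp p) \sum_(v <- msupp q)
    (p@_u * q@_v) *: \sum_(w <- word_shuffle u v) << w >>.

Definition shuffle_exp (p : {malg R[seq A]}) (k : nat) : {malg R[seq A]} :=
  iter k (shuffle p) << [::] >>.

(* The words that do not begin with c satisfy ohead w <> Some c; this includes
   the empty word. *)
Definition span_not_beginning (c : A) : set {malg R[seq A]} :=
  linear_span [set << w >> | w in [set w : seq A | ohead w <> Some c]].

End Shuffle.

(* Main.v *)
(* Let [D] erase a leading letter [c] and kill every word that does not begin
   with [c].  Then [D] is a derivation of the shuffle product, it is locally
   nilpotent, its kernel is [Z], and [D c = e].  Hence
   [D (z ⧢ c^k) = k (z ⧢ c^(k-1))] for [z] in [Z], and the decomposition is the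
   Taylor expansion of a vector along [c] in characteristic zero: independence
   follows by applying [D] to a relation, and spanning by integrating [D v]
   term by term, which gives [v] up to an element of [ker D]. *)
Require Import Defs.
From HB Require Import structures.
From mathcomp Require Import all_boot all_order all_algebra.
From mathcomp Require Import finmap.
From mathcomp Require Import boolp classical_sets reals.
From mathcomp.multinomials Require Import monalg.

Import Order.TTheory GRing.Theory Num.Theory.

Local Open Scope classical_set_scope.
Local Open Scope ring_scope.

(** * Direct sums indexed by the natural numbers, via partial sums *)

Section DirectSum.
Context {R : nzRingType} {V : lmodType R}.
Implicit Types (U : nat -> set V) (f : {fsfun nat -> V with 0}).

Lemma sum_finsupp_ord f n : (forall k, (n <= k)%N -> f k = 0) ->
  \sum_(k <- finsupp f) f k = \sum_(k < n) f k.
Proof.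
move=> f0; rewrite -(big_mkord xpredT) /index_iota subn0.
rewrite [RHS](bigID (mem (finsupp f))) /= [X in _ + X]big1 => [|k kf]; last first.
  exact: fsfun_dflt.
rewrite addr0 -[RHS]big_filter; apply: perm_big; apply: uniq_perm.
- exact: fset_uniq.
- exact/filter_uniq/iota_uniq.
move=> k; rewrite mem_filter mem_iota /= add0n.
have [kf|//] := boolP (k \in finsupp f); rewrite /= ltnNge.
by apply/esym/negP => /f0 /eqP; apply/negP; rewrite -mem_finsupp.
Qed.

Lemma finsupp_bound f : exists n, forall k, (n <= k)%N -> f k = 0.
Proof.
exists (\max_(k <- finsupp f) k)%N.+1 => k; apply: contraTeq => fk0.
by rewrite -leqNgt leq_bigmax_seq // mem_finsupp.
Qed.

(** Two finitely supported families vanish beyond a common bound, so if their sums agree, their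
    difference is a null partial sum of elements of the [U k]. This turns uniqueness into
    independence of initial segments. *)
Lemma direct_sum_of_partial_sums U :
  (forall k, is_linear_subspace (U k)) ->
  (forall v, exists n g, (forall k, U k (g k)) /\ v = \sum_(k < n) g k) ->
  (forall n g, (forall k, U k (g k)) -> \sum_(k < n) g k = 0 ->
     forall k, (k < n)%N -> g k = 0) ->
  is_direct_sum U.
Proof.
move=> subU spanU freeU; split=> // v.
have [n [g [gU ->]]] := spanU v.
(* [g] may be nonzero from [n] on, so it is truncated there. *)
pose f : {fsfun nat -> V with 0} := [fsfun k in [fset i in iota 0 n]%fset => g k].
have fE k : f k = if (k < n)%N then g k else 0.
  by rewrite fsfunE !inE /= mem_iota add0n.
have sumf : \sum_(k < n) g k = \sum_(k <- finsupp f) f k.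
  rewrite (@sum_finsupp_ord _ n) => [|k nk]; last by rewrite fE ltnNge nk.
  by apply: eq_bigr => k _; rewrite fE ltn_ord.
have fU k : U k (f k).
  by rewrite fE; case: ifP => // _; case: (subU k).
exists f; split=> // h [hU]; rewrite sumf => sumh.
have [m f0] := finsupp_bound f; have [p h0] := finsupp_bound h.
have f0' k : (maxn m p <= k)%N -> f k = 0 by rewrite geq_max => /andP[/f0].
have h0' k : (maxn m p <= k)%N -> h k = 0 by rewrite geq_max => /andP[_ /h0].
apply/fsfunP => k; have [kmp|kmp] := ltnP k (maxn m p); last first.
  by rewrite f0' ?h0'.
apply/eqP; rewrite -subr_eq0; apply/eqP.
move: k kmp; apply: (freeU _ (fun k => f k - h k)) => [k|].
  have [_ linU] := subU k.
  by rewrite addrC -scaleN1r; exact: linU.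
by rewrite sumrB -!sum_finsupp_ord // -sumh subrr.
Qed.

End DirectSum.

(** * Taylor expansion for a locally nilpotent operator *)

Section IntegrableDerivation.
Context {R : numFieldType} {V : lmodType R}.
Variables (D : {linear V -> V}) (T : nat -> {linear V -> V}).
(** The model is [D] = d/dx, with [T k] the multiplication by the undivided power x^k, whence the
    factor [k.+1] below. *)
Hypothesis T0 : forall z, T 0%N z = z.
Hypothesis D_TS : forall k z, D z = 0 -> D (T k.+1 z) = k.+1%:R *: T k z.

Let U k : set V := [set T k z | z in [set z | D z = 0]].

(** [D] kills the term of index 0 and turns the others into a shorter relation among the kernel
    elements [j.+1%:R *: z j.+1]. By induction these vanish, characteristic zero cancels the
    factors, and only [z 0] remains in the original relation. *)
Lemma ker_sum_independent n (z : nat -> V) :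
  (forall k, D (z k) = 0) -> \sum_(k < n) T k (z k) = 0 ->
  forall k, (k < n)%N -> z k = 0.
Proof.
elim: n z => // n IHn z Dz; rewrite big_ord_recl /= T0 => sumz.
have zS k : (k < n)%N -> z k.+1 = 0.
  move=> kn; have Dz' j : D (j.+1%:R *: z j.+1) = 0.
    by rewrite linearZ /= Dz scaler0.
  have sumz' : \sum_(j < n) T j (j.+1%:R *: z j.+1) = 0.
    move/(congr1 D): sumz; rewrite linearD /= Dz add0r linear0 linear_sum.
    by apply: etrans; apply: eq_bigr => j _; rewrite D_TS // linearZ.
  have /eqP := IHn (fun j => j.+1%:R *: z j.+1) Dz' sumz' k kn.
  by rewrite scaler_eq0 pnatr_eq0 => /eqP.
case=> [_|k /zS//]; move: sumz; rewrite big1 ?addr0 // => j _.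
by rewrite zS // linear0.
Qed.

Lemma ker_sum_spans n v : iter n D v = 0 ->
  exists z : nat -> V,
    (forall k, D (z k) = 0) /\ v = \sum_(k < n) T k (z k).
Proof.
elim: n v => [|n IHn] v; first by move=> /= ->; exists (fun=> 0); split=> [k|];
  rewrite ?linear0 ?big_ord0.
rewrite iterSr => /IHn [z [Dz Dv]].
(* The termwise antiderivative of the expansion of [D v]; the constant of integration [v - y] then
   serves as the component of index 0. *)
pose y := \sum_(k < n) T k.+1 (k.+1%:R^-1 *: z k).
have Dy : D y = D v.
  rewrite Dv linear_sum; apply: eq_bigr => k _.
  rewrite D_TS; last by rewrite linearZ /= Dz scaler0.
  by rewrite linearZ scalerA mulfV ?pnatr_eq0 // scale1r.
exists (fun k => if k is j.+1 then j.+1%:R^-1 *: z j else v - y); split.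
  by case=> [|k]; rewrite ?linearZ ?linearB /= ?Dz ?scaler0 // Dy subrr.
by rewrite big_ord_recl /= T0 subrK.
Qed.

Lemma ker_direct_sum : (forall v, exists n, iter n D v = 0) ->
  is_direct_sum U.
Proof.
move=> nilD; apply: direct_sum_of_partial_sums.
- move=> k; split; first by exists 0; rewrite /= linear0.
  move=> a _ _ [x Dx <-] [y Dy <-]; exists (a *: x + y); rewrite /= linearP //.
  by rewrite Dx Dy scaler0 addr0.
- move=> v; have [n /ker_sum_spans [z [Dz vE]]] := nilD v.
  by exists n, (fun k => T k (z k)); split=> // k; exists (z k).
(* Independence is known for kernel elements, so a preimage under [T k] is chosen for each [g k]. *)
- move=> n g gU; have /choice [z zP] k : exists z, D z = 0 /\ T k z = g k.
    by have [z] := gU k; exists z.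
  rewrite (eq_bigr (fun k : 'I_n => T k (z k))) => [|k _]; last by case: (zP k).
  move=> sumz k kn; have [_ <-] := zP k.
  by rewrite (@ker_sum_independent n) ?linear0 // => j; case: (zP j).
Qed.

End IntegrableDerivation.

(** * Linear maps out of a free module *)

Section FreeModule.
Context {R : nzRingType} {K : choiceType} {M : lmodType R}.
Implicit Types (h : K -> M) (p q : {malg R[K]}).

(** The linear map given by the universal property of the free module on [K]. *)
Definition free_ext h p : M := \sum_(k <- msupp p) p@_k *: h k.

Lemma free_extEw (S : {fset K}) h p : (msupp p `<=` S)%fset ->
  free_ext h p = \sum_(k <- S) p@_k *: h k.
Proof.
by move=> pS; apply: big_fset_incl => // k _ /mcoeff_outdom ->; rewrite scale0r.
Qed.

Lemma free_ext_is_linear h : linear (free_ext h).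
Proof.
move=> a p q; pose S := (msupp p `|` msupp q)%fset.
rewrite !(@free_extEw S) ?fsubsetUl ?fsubsetUr //; last first.
  apply: fsubset_trans (msuppD_le _ _) _.
  exact: fsetUSS (msuppZ_le _ _) (fsubset_refl _).
rewrite scaler_sumr -big_split /=; apply: eq_bigr => k _.
by rewrite mcoeffD mcoeffZ scalerDl scalerA.
Qed.

HB.instance Definition _ h :=
  GRing.isLinear.Build R {malg R[K]} M *:%R (free_ext h) (free_ext_is_linear h).

Lemma free_extU h k : free_ext h << k >> = h k.
Proof. by rewrite /free_ext msuppU oner_eq0 big_seq_fset1 mcoeffUU scale1r. Qed.

Lemma linear_on_basis (f : {linear {malg R[K]} -> M}) p :
  f p = free_ext (fun k => f << k >>) p.
Proof.
rewrite {1}[p]monalgE linear_sum; apply: eq_bigr => k _.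
rewrite -linearZ; congr (f _); apply/malgP => j.
by rewrite mcoeffZ !mcoeffU mulrnAr mulr1.
Qed.

Lemma eq_free_ext h1 h2 : h1 =1 h2 -> free_ext h1 =1 free_ext h2.
Proof. by move=> h12 p; apply: eq_bigr => k _; rewrite h12. Qed.

Lemma linear_eq_on_basis (f g : {linear {malg R[K]} -> M}) :
  (forall k, f << k >> = g << k >>) -> f =1 g.
Proof.
move=> fg p; rewrite (linear_on_basis f) (linear_on_basis g).
exact: eq_free_ext.
Qed.

End FreeModule.

Lemma free_ext_basis (R : nzRingType) (K : choiceType) (p : {malg R[K]}) :
  free_ext (fun k => << k >>) p = p.
Proof. exact/esym/(linear_on_basis idfun). Qed.

(** * Erasing a leading letter as a derivation of the shuffle product *)

Section ShuffleDerivation.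
Context {R : comNzRingType} {A : choiceType}.
Implicit Types (u v w : seq A) (p q z : {malg R[seq A]}).

Definition word_shuffle_sum u v : {malg R[seq A]} :=
  \sum_(w <- word_shuffle u v) << w >>.

(** As an iterated linear extension, the product inherits its linearity and its values on words from
    [free_ext]. *)
Lemma shuffleE p q :
  shuffle p q = free_ext (fun u => free_ext (word_shuffle_sum u) q) p.
Proof.
apply: eq_bigr => u _; rewrite scaler_sumr.
by apply: eq_bigr => v _; rewrite scalerA.
Qed.

Lemma shuffleUU u v : shuffle << u >> << v >> = word_shuffle_sum u v.
Proof. by rewrite shuffleE !free_extU. Qed.

Lemma shuffle_is_linear_l q : linear (fun p => shuffle p q).
Proof. by move=> a p1 p2; rewrite !shuffleE linearP. Qed.

(** A scalar from the second factor must move past the coefficients of [p]; commutativity of [R]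
    allows this. *)
Lemma shuffle_is_linear_r p : linear (shuffle p).
Proof.
move=> a q1 q2; rewrite !shuffleE /free_ext scaler_sumr -big_split /=.
apply: eq_bigr => u _; rewrite -!/(free_ext _ _) linearP scalerDr !scalerA.
by rewrite mulrC.
Qed.

Definition shufflel q p := shuffle p q.

HB.instance Definition _ q := GRing.isLinear.Build R {malg R[seq A]}
  {malg R[seq A]} *:%R (shufflel q) (shuffle_is_linear_l q).
HB.instance Definition _ p := GRing.isLinear.Build R {malg R[seq A]}
  {malg R[seq A]} *:%R (shuffle p) (shuffle_is_linear_r p).

Lemma shuffle1p p : shuffle << [::] >> p = p.
Proof.
rewrite shuffleE free_extU -[RHS]free_ext_basis; apply: eq_free_ext => v.
by rewrite /word_shuffle_sum /= big_seq1.
Qed.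

Lemma shufflep1 p : shuffle p << [::] >> = p.
Proof.
rewrite shuffleE -[RHS]free_ext_basis; apply: eq_free_ext => u.
by rewrite free_extU; case: u => [|a u]; rewrite /word_shuffle_sum /= big_seq1.
Qed.

Variable c : A.

Definition erase_head : {malg R[seq A]} -> {malg R[seq A]} :=
  free_ext (fun u => if u is a :: u' then (a == c)%:R *: << u' >> else 0).

HB.instance Definition _ := GRing.Linear.on erase_head.

Lemma erase_head_nil : erase_head << [::] >> = 0.
Proof. exact: free_extU. Qed.

Lemma erase_head_cons a u :
  erase_head << a :: u >> = (a == c)%:R *: << u >>.
Proof. exact: free_extU. Qed.

(** [erase_head] is the transpose of prefixing by [c]; its kernel and its nilpotency can thus be
    read off coefficients. *)
Lemma mcoeff_erase_head p w : (erase_head p)@_w = p@_(c :: w).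
Proof.
rewrite [in RHS](monalgE p) !raddf_sum; apply: eq_bigr => u _ /=.
rewrite mcoeffZ mcoeffU; case: u => [|a u]; first by rewrite mcoeff0 mulr0.
rewrite mcoeffZ mcoeffU eqseq_cons -mulnb mulrnA -[in RHS]mulr_natr.
by rewrite -mulr_natr !mul1r mulrA mulr_natr.
Qed.

Lemma mcoeff_iter_erase_head n p w :
  (iter n erase_head p)@_w = p@_(nseq n c ++ w).
Proof.
elim: n w => // n IHn w.
by rewrite iterS mcoeff_erase_head IHn -cat_rcons -[n.+1]addn1 nseqD -cats1.
Qed.

Lemma erase_head_nilpotent p : exists n, iter n erase_head p = 0.
Proof.
(* One more than the longest length in the support: any word starting with that many letters [c] is
   too long to occur in [p]. *)
exists (\max_(u <- msupp p) size u)%N.+1; apply/malgP => w.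
rewrite mcoeff_iter_erase_head mcoeff0; apply: mcoeff_outdom.
apply/negP => wp; have := @leq_bigmax_seq _ _ xpredT size _ wp isT.
by rewrite size_cat size_nseq leqNgt leq_addr.
Qed.

(** In au ⧢ bv = a(u ⧢ bv) + b(au ⧢ v) the two summands expose the heads of the two factors, and
    erasing them gives the two Leibniz terms. Empty words are covered by the unit laws. *)
Lemma erase_head_word_shuffle u v :
  erase_head (word_shuffle_sum u v) =
  shuffle (erase_head << u >>) << v >> + shuffle << u >> (erase_head << v >>).
Proof.
have shuffle0 q : shuffle 0 q = 0 := linear0 (shufflel q).
have shuffleZl a p q : shuffle (a *: p) q = a *: shuffle p q.
  by rewrite -/(shufflel q _) linearZ.
case: u => [|a u].
  rewrite erase_head_nil shuffle0 add0r shuffle1p.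
  by rewrite /word_shuffle_sum big_seq1.
case: v => [|b v].
  rewrite erase_head_nil linear0 addr0 shufflep1.
  by rewrite /word_shuffle_sum big_seq1.
rewrite !erase_head_cons shuffleZl linearZ /= !shuffleUU /word_shuffle_sum.
rewrite [word_shuffle (a :: u) (b :: v)]/= big_cat !big_map.
rewrite linearD !linear_sum /=.
by congr +%R; apply: eq_bigr => w _; rewrite erase_head_cons.
Qed.

(** Both sides are bilinear, so the Leibniz rule reduces to words, first in [p] and then in [q]. *)
Lemma erase_head_shuffle p q :
  erase_head (shuffle p q) =
  shuffle (erase_head p) q + shuffle p (erase_head q).
Proof.
pose lhs q : {linear _ -> _} := erase_head \o shufflel q.
pose rhs q : {linear _ -> _} :=
  (shufflel q \o erase_head) \+ shufflel (erase_head q).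
apply: (linear_eq_on_basis (lhs q) (rhs q)) => u.
pose lhs_u : {linear _ -> _} := erase_head \o shuffle << u >>.
pose rhs_u : {linear _ -> _} :=
  shuffle (erase_head << u >>) \+ (shuffle << u >> \o erase_head).
apply: (linear_eq_on_basis lhs_u rhs_u) => v /=.
by rewrite shuffleUU erase_head_word_shuffle.
Qed.

Lemma erase_head_shuffle_exp k :
  erase_head (shuffle_exp << [:: c] >> k.+1) =
  k.+1%:R *: shuffle_exp << [:: c] >> k.
Proof.
elim: k => [|k IHk]; rewrite /shuffle_exp iterS -/(shuffle_exp _ _);
  rewrite erase_head_shuffle erase_head_cons eqxx !scale1r shuffle1p.
  by rewrite erase_head_nil linear0 addr0.
by rewrite IHk linearZ /= -[in RHS]natr1 addrC scalerDl scale1r.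
Qed.

Lemma ker_erase_head :
  span_not_beginning c = [set z : {malg R[seq A]} | erase_head z = 0].
Proof.
apply/seteqP; split=> z /=.
  move=> [s sZ ->]; rewrite linear_sum big_seq big1 // => -[a x] /sZ /=.
  move=> [[|b u] /= bc <-]; rewrite linearZ /= ?erase_head_nil ?scaler0 //.
  rewrite erase_head_cons; case: eqP bc => [->//|_ _].
  by rewrite scale0r scaler0.
(* The expansion of [z] on its support works: a support word [c :: u] would have as coefficient that
   of [erase_head z] at [u], which is zero. *)
move=> Dz; exists [seq (z@_u, << u >>) | u <- msupp z].
  move=> _ /mapP[u uz ->] /=; exists u => //.
  case: u uz => [//|b u] /= uz [bc]; move: uz.
  by rewrite bc -mcoeff_neq0 -mcoeff_erase_head Dz mcoeff0 eqxx.
by rewrite big_map; exact/esym/free_ext_basis.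
Qed.

End ShuffleDerivation.

Theorem lemma5p39 (R : realType) (d : Order.disp_t) (A : finOrderType d)
    (c : A) (c_greatest : forall a : A, (a <= c)%O) :
  is_direct_sum (fun k : nat =>
    [set shuffle z (shuffle_exp << [:: c] >> k)
      | z in span_not_beginning c : set {malg R[seq A]}]).
Proof.
rewrite ker_erase_head.
apply: (@ker_direct_sum R _ (erase_head c)
          (fun k => shufflel (shuffle_exp << [:: c] >> k))).
- exact: shufflep1.
(* By the Leibniz rule with [erase_head z = 0], only the derivative of the power of [c] survives. *)
- move=> k z Dz; rewrite /= /shufflel erase_head_shuffle Dz.
  by rewrite -/(shufflel _ 0) linear0 add0r erase_head_shuffle_exp linearZ.
- exact: erase_head_nilpotent.
Qed.
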